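(* Let $\alpha>0$, $L>0$, and let $\mathcal{H}$ be an infinite dimensional Hilbert space with fixed orthonormal basis $\{|e_j\rangle\}_{j\ge0}$. Let $\rho_0=|\psi_0\rangle\langle\psi_0|$ be a fixed pure state with $\rho_0\in S^\alpha(L')$ for some $L'<L$. In the i.i.d. quantum model $\mathcal{Q}_n=\{\rho^{\otimes n}:\rho\in S^\alpha(L)\}$ consider the testing problem $$H_0:\ \rho=\rho_0,\qquad H_1(\varphi_n):\ \rho\in S^\alpha(L)\cap B(\varphi_n),$$ where $B(\varphi)=\{\rho\text{ pure}:\ \|\rho-\rho_0\|_1\ge\varphi\}$ and $\{\varphi_n\}_{n\ge1}$ is a decreasing sequence of positive real numbers. If the radius is at the minimax separation rate, i.e. $\varphi_n\asymp n^{-1/2}$, then $$\lim_{n\to\infty}\ n^{-1}\varphi_n^{-2}\,\log\mathbb{P}_e^*(\varphi_n)=-\frac14.$$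
   Context: The Hermite-Sobolev class is $S^\alpha(L)=\{|\psi\rangle\langle\psi|:\ \sum_{j=0}^\infty|\psi_j|^2j^{2\alpha}\le L,\ \|\psi\|=1\}$, where $\psi_j=\langle e_j|\psi\rangle$. The trace norm is $\|\tau\|_1=\mathrm{Tr}(|\tau|)$, $|\tau|=(\tau^*\tau)^{1/2}$. $\varphi_n\asymp n^{-1/2}$ means that $n^{1/2}\varphi_n$ is bounded above and bounded away from $0$. A binary POVM on $\mathcal{H}^{\otimes n}$ is a pair $M=(M_0,M_1)$ of positive bounded operators with $M_0+M_1=\mathbf 1$ ($M_1$ corresponds to rejecting $H_0$). The worst case total error probability of $M$ is $$\mathbb{P}_e^M(\varphi_n)=\mathrm{Tr}(\rho_0^{\otimes n}M_1)+\sup_{\rho\in S^\alpha(L)\cap B(\varphi_n)}\mathrm{Tr}(\rho^{\otimes n}M_0),$$ and the minimax total error probability is $\mathbb{P}_e^*(\varphi_n)=\inf_M\mathbb{P}_e^M(\varphi_n)$, the infimum being over all binary POVMs $M$ on $\mathcal{H}^{\otimes n}$. *)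

(* Defs.v *)
From HB Require Import structures.
From mathcomp Require Import all_boot all_order all_algebra finmap.
From mathcomp Require Import all_classical all_reals all_analysis.
From mathcomp Require Import complex summability.

Set Implicit Arguments.
Unset Strict Implicit.
Unset Printing Implicit Defensive.

Import Order.TTheory GRing.Theory Num.Theory.
Import numFieldNormedType.Exports.

Local Open Scope classical_set_scope.
Local Open Scope ring_scope.

HB.mixin Record CompleteNormedModule_isHilbert (R : realType) V
    of CompleteNormedModule R[i] V := {
  innerp : {dot V for Num.conj};
  innerp_norm : forall x : V, `|x| ^+ 2 = innerp x x
}.

#[short(type="hilbertType")]
HB.structure Definition Hilbert (R : realType) :=
  {V of CompleteNormedModule_isHilbert R V & CompleteNormedModule R[i] V}.

(* [innerp] is linear in its first argument; the bracket is linear in the ket. *)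
Notation "<( x | y )>" := (innerp y x) (format "<( x | y )>").

Section hilbert.
Context {R : realType} {H : hilbertType R}.

Definition total_family (I : Type) (e : I -> H) :=
  forall x, closure [set y | exists (s : seq I) (c : I -> R[i]),
                             y = \sum_(i <- s) c i *: e i] x.

Definition orthonormal_basis (I : choiceType) (e : I -> H) :=
  (forall i j, <(e i | e j)> = (i == j)%:R) /\ total_family e.

Definition bounded_op (A : H -> H) := linear A /\ continuous A.

Definition positive_op (A : H -> H) :=
  bounded_op A /\ forall x, 0 <= <(x | A x)>.

Definition adjoint_of (A B : H -> H) := forall x y, <(B x | y)> = <(x | A y)>.

(* The sum of the diagonal entries converges unconditionally to [z] in every
   orthonormal basis, of whatever index type: this is basis-free, and it holds
   of the usual trace of a trace-class operator. *)
Definition has_trace (A : H -> H) (z : R[i]) :=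
  forall (I : choiceType) (e : I -> H), orthonormal_basis e ->
    partial_sum (fun i => <(e i | A (e i))> : R[i]^o) @ totally
      --> (z : R[i]^o).

(* [xget d P] is an element of [P] if there is one, and the junk value [d]
   otherwise. *)
Definition trace (A : H -> H) : R[i] := xget 0 [set z | has_trace A z].

(* The positive square root of [A^* A]. *)
Definition abs_op (A : H -> H) : H -> H :=
  xget (fun=> 0) [set S | positive_op S /\
    exists2 B : H -> H, adjoint_of A B & S \o S = B \o A].

Definition trace_norm (A : H -> H) : R := complex.Re (trace (abs_op A)).

Definition ketbra (psi : H) : H -> H := fun x => <(psi | x)> *: psi.

Definition pure_state : set (H -> H) :=
  [set rho | exists2 psi, `|psi| = 1 & rho = ketbra psi].

Definition hermite_sobolev (e : nat -> H) (alpha L : R) : set (H -> H) :=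
  [set rho | exists psi,
    [/\ `|psi| = 1,
        (\sum_(0 <= j <oo)
           (complex.Re (`| <(e j | psi)> | ^+ 2) * j%:R `^ (2 * alpha))%:E
           <= L%:E)%E
      & rho = ketbra psi]].

Definition separated (rho0 : H -> H) (phi : R) : set (H -> H) :=
  [set rho | pure_state rho /\ phi <= trace_norm (fun x => rho x - rho0 x)].

End hilbert.

(* The Hilbert space tensor power, characterised up to unitary isomorphism
   commuting with the product vectors [tens u] (whose multilinearity in [u]
   follows from [tens_innerp]); one realisation is l^2(nat^n). *)
Record tensor_power (R : realType) (H : hilbertType R) (n : nat) := {
  tensor_space :> hilbertType R;
  tens : ('I_n -> H) -> tensor_space;
  tens_innerp : forall u v, <(tens u | tens v)> = \prod_(i < n) <(u i | v i)>;
  tens_total : total_family tens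
}.

Section testing.
Context {R : realType} {H : hilbertType R} {n : nat} (K : tensor_power H n).

Definition op_power (A : H -> H) : K -> K :=
  xget (fun=> 0) [set B | bounded_op B /\
    forall u, B (tens K u) = tens K (fun i => A (u i))].

Definition binary_povm : set ((K -> K) * (K -> K)) :=
  [set M | [/\ positive_op M.1, positive_op M.2
             & forall x, M.1 x + M.2 x = x]].

(* [M.2] rejects the null hypothesis.  The traces are real and lie in [0, 1];
   the supremum over an empty alternative is [sup set0 = 0]. *)
Definition total_error (e : nat -> H) (alpha L : R) (rho0 : H -> H) (phi : R)
    (M : (K -> K) * (K -> K)) : R :=
  complex.Re (trace (op_power rho0 \o M.2)) +
  sup [set complex.Re (trace (op_power rho \o M.1)) | rho in
         hermite_sobolev e alpha L `&` separated rho0 phi].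

Definition minimax_error (e : nat -> H) (alpha L : R) (rho0 : H -> H)
    (phi : R) : R :=
  inf [set total_error e alpha L rho0 phi M | M in binary_povm].

End testing.

Definition separation_rate (R : realType) (phi : nat -> R) :=
  exists c C : R, 0 < c /\
    forall n, (0 < n)%N -> c <= Num.sqrt n%:R * phi n <= C.

(* Main.v *)
(* The minimax error is exactly (1 - phi^2 / 4)^n once phi is small. Pure states
   satisfy |rho - rho_0|_1 = 2 sqrt (1 - f) with f the overlap, so the
   alternative is f <= 1 - phi^2 / 4, and the projection onto psi_0^{(x) n}
   attains the upper bound. For the lower bound, take a unit vector v orthogonal
   to psi_0 and spanned by e_0 and e_1, and average the power states of
   r psi_0 + z s v, where s = phi / 2 and r^2 + s^2 = 1, over the (n+1)-th roots
   of unity z: the mean of the vectors (r psi_0 + z s v)^{(x) n} is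
   r^n psi_0^{(x) n}, so by convexity of x |-> <x | M_0 x> the mean error of the
   second kind is at least r^{2n} <psi_0^{(x) n} | M_0 psi_0^{(x) n}>. The gap
   between L' and L keeps these states in the Sobolev class. *)

Require Import Defs.
From mathcomp Require Import all_boot all_order all_algebra.
From mathcomp Require Import all_classical all_reals all_analysis.
From mathcomp Require Import finmap cyclic separable cyclotomic complex summability.
From mathcomp Require Import ring lra.
Import Order.TTheory GRing.Theory Num.Theory.
Import numFieldNormedType.Exports.
Local Open Scope classical_set_scope.
Local Open Scope ring_scope.

Set Implicit Arguments.
Unset Strict Implicit.
Unset Printing Implicit Defensive.

#[local] Existing Instance totally_filter.

(** Reduces a consequence of linear equations to a ring identity between differences, which [ring]
    decides. *)
Lemma eq_of_subr_eq (Z : zmodType) (a b c d : Z) : c = d -> a - b = c - d -> a = b.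
Proof. by move=> ->; rewrite subrr => /subr0_eq. Qed.

Lemma Re_le (R : realType) (x y : R[i]) : x <= y -> complex.Re x <= complex.Re y.
Proof. by rewrite lecE => /andP[]. Qed.

Lemma Re_ge0 (R : realType) (x : R[i]) : 0 <= x -> 0 <= complex.Re x.
Proof. exact: Re_le. Qed.

Section linear_maps.
Context {K : pzRingType} {U W : lmodType K} (A : U -> W).
Hypothesis lA : linear A.

Lemma linear_map0 : A 0 = 0.
Proof. by have := lA 1 0 0; rewrite !scale1r addr0 -{1}[A 0]addr0 => /addrI. Qed.

Lemma linear_mapZ a u : A (a *: u) = a *: A u.
Proof. by have := lA a u 0; rewrite !addr0 linear_map0 addr0. Qed.

Lemma linear_mapB u v : A (u - v) = A u - A v.
Proof. by rewrite addrC -scaleN1r lA scaleN1r addrC. Qed.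

End linear_maps.

(* Here g, h stand for <x | A y>, <y | A x> and g', h' for their conjugates: the
   hypotheses say that <u | A u> is real for u = x + y and u = x + i y. *)
Lemma polarization_conj (F : numFieldType) (i g h g' h' p q : F) :
  i != 0 ->
  p + g' + (h' + q) = p + g + (h + q) ->
  p + - i * g' + (i * h' + - i * (i * q)) =
    p + i * g + (- i * h + i * (- i * q)) ->
  h' = g.
Proof.
move=> i0 H1 H2.
have E1 : g' + h' = g + h by apply: (eq_of_subr_eq H1); ring.
have E2 : i * (h' - g') = i * (g - h) by apply: (eq_of_subr_eq H2); ring.
have {}E2 := mulfI i0 E2.
have two : 2 != 0 :> F by rewrite pnatr_eq0.
apply: (mulfI two); apply: (eq_of_subr_eq (congr2 +%R E1 E2)); ring.
Qed.

(** * Inner products and positive operators *)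

Section inner_product.
Context {R : realType} {V : hilbertType R}.
Implicit Types (x y z : V) (a b c : R[i]).

Lemma innerp_conj x y : Num.conj <(x | y)> = <(y | x)>.
Proof. by rewrite [RHS]hermC expr0 mul1r. Qed.

Lemma innerpDr x y z : <(x | y + z)> = <(x | y)> + <(x | z)>.
Proof. exact: linearDl. Qed.

Lemma innerpBr x y z : <(x | y - z)> = <(x | y)> - <(x | z)>.
Proof. exact: linearBl. Qed.

Lemma innerpZr a x y : <(x | a *: y)> = a * <(x | y)>.
Proof. exact: linearZl_LR. Qed.

Lemma innerp0r x : <(x | 0)> = 0.
Proof. exact: linear0l. Qed.

Lemma innerp_sumr (I : Type) (r : seq I) (P : pred I) (F : I -> V) x :
  <(x | \sum_(i <- r | P i) F i)> = \sum_(i <- r | P i) <(x | F i)>.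
Proof. exact: linear_sumlz. Qed.

Lemma innerpDl x y z : <(x + y | z)> = <(x | z)> + <(y | z)>.
Proof. exact: linearDr. Qed.

Lemma innerpBl x y z : <(x - y | z)> = <(x | z)> - <(y | z)>.
Proof. exact: linearBr. Qed.

Lemma innerpZl a x y : <(a *: x | y)> = Num.conj a * <(x | y)>.
Proof. exact: linearZr_LR. Qed.

Lemma innerp0l x : <(0 | x)> = 0.
Proof. exact: linear0r. Qed.

Lemma innerp_suml (I : Type) (r : seq I) (P : pred I) (F : I -> V) x :
  <(\sum_(i <- r | P i) F i | x)> = \sum_(i <- r | P i) <(F i | x)>.
Proof. exact: linear_sumr. Qed.

Lemma innerp_ge0 x : 0 <= <(x | x)>.
Proof. by rewrite -innerp_norm exprn_ge0. Qed.

Lemma innerp_eq0 x : <(x | x)> = 0 -> x = 0.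
Proof. by rewrite -innerp_norm => /eqP; rewrite sqrf_eq0 normr_eq0 => /eqP. Qed.

Lemma innerp_ext x y : (forall z, <(z | x)> = <(z | y)>) -> x = y.
Proof. by move=> E; apply/subr0_eq/innerp_eq0; rewrite innerpBr E subrr. Qed.

Lemma normr_innerp x y : `|<(x | y)>| ^+ 2 = <(x | y)> * <(y | x)>.
Proof. by rewrite normCK innerp_conj. Qed.

Lemma cauchy_schwarz x y : `|<(x | y)>| <= `|x| * `|y|.
Proof.
have [->|x0] := eqVneq x 0; first by rewrite innerp0l !normr0 mul0r.
have xx0 : 0 < <(x | x)> by rewrite -innerp_norm exprn_gt0 ?normr_gt0.
rewrite -(@ler_pXn2r _ 2) // ?nnegrE ?mulr_ge0 //.
rewrite exprMn !innerp_norm normr_innerp.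
(* This vector is [<(x | x)>] times the component of [y] orthogonal to [x]; its squared norm is p (p
   t - q s). *)
have := innerp_ge0 (<(x | x)> *: y - <(x | y)> *: x).
rewrite innerpBr !innerpBl !innerpZr !innerpZl !innerp_conj.
set p := <(x | x)>; set q := <(x | y)>; set s := <(y | x)>; set t := <(y|y)>.
have -> : p * (p * t) - p * (s * q) - (q * (p * s) - q * (s * p))
        = p * (p * t - q * s).
  by ring.
by rewrite pmulr_rge0 // subr_ge0.
Qed.

Lemma innerp_unit x : `|x| = 1 -> <(x | x)> = 1.
Proof. by move=> x1; rewrite -innerp_norm x1 expr1n. Qed.

Lemma innerp_le1 x y : `|x| = 1 -> `|y| = 1 -> `|<(x | y)>| <= 1.
Proof. by move=> x1 y1; rewrite (le_trans (cauchy_schwarz _ _)) // x1 y1 mulr1. Qed.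

(** Polarization: [<(u | A u)>] is real for u = x + y and for u = x + i y. *)
Lemma selfadjoint_of_ge0 (A : V -> V) : linear A ->
  (forall x, 0 <= <(x | A x)>) -> forall x y, <(A x | y)> = <(x | A y)>.
Proof.
move=> lA pA x y.
have AD u v : A (u + v) = A u + A v by have := lA 1 u v; rewrite !scale1r.
have AZ c u : A (c *: u) = c *: A u by exact: linear_mapZ.
have real u : Num.conj <(u | A u)> = <(u | A u)> by apply: geC0_conj.
have H1 := real (x + y); have Hx := real x; have Hy := real y.
have H2 := real (x + 'i *: y).
rewrite AD !(innerpDl, innerpDr) !rmorphD /= Hx Hy in H1.
rewrite AD AZ !(innerpDl, innerpDr, innerpZl, innerpZr) in H2.
rewrite !rmorphD !rmorphM /= conjCK conjCi Hx Hy in H2.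
rewrite -innerp_conj.
set g := <(x | A y)> in H1 H2 *; set h := <(y | A x)> in H1 H2 *.
set g' := Num.conj g in H1 H2; set h' := Num.conj h in H1 H2 *.
exact: polarization_conj (neq0Ci _) H1 H2.
Qed.

(** With z = A y, the form at y - t z is t^2 <z | A z> - 2 t <z | z>. It is nonnegative for all real
    t, so the linear term must vanish. *)
Lemma positive_op_eq0 (A : V -> V) : linear A ->
  (forall x, 0 <= <(x | A x)>) -> forall y, <(y | A y)> = 0 -> A y = 0.
Proof.
move=> lA pA y y0; set z := A y.
have H t : t ^+ 2 * <(z | A z)> - t * <(z | z)> *+ 2 >= 0 \/ t \isn't Num.real.
  have [tr|] := boolP (t \is Num.real); [left|by right].
  have := pA (- t *: z + y); rewrite lA -/z.
  rewrite !(innerpDr, innerpDl, innerpZl, innerpZr) rmorphN /= (CrealP tr).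
  rewrite -(selfadjoint_of_ge0 lA pA y z) -/z y0.
  move=> H0; apply: (le_trans H0); rewrite le_eqVlt; apply/orP; left; apply/eqP; ring.
have q0 : 0 < 1 + <(z | A z)> by rewrite ltr_wpDr ?ltr01.
set q := <(z | A z)> in H q0; set p := <(z | z)> in H.
have p0 : 0 <= p := innerp_ge0 z.
(* At t = p / (1 + q) the quadratic equals - t^2 (2 + q), which forces p = 0; the added 1 keeps the
   denominator positive. *)
have [|/negP[]] := H (p / (1 + q)); last first.
  by rewrite realM ?realV ?ger0_real // ltW.
have -> : (p / (1 + q)) ^+ 2 * q - p / (1 + q) * p *+ 2
   = - (p / (1 + q)) ^+ 2 * (2 + q).
  by field; rewrite gt_eqF.
rewrite mulNr oppr_ge0 => Hle.
apply: innerp_eq0; rewrite -/p; apply/eqP.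
have : (p / (1 + q)) ^+ 2 * (2 + q) == 0.
  rewrite eq_le Hle mulr_ge0 //.
    by rewrite exprn_ge0 // divr_ge0 // ltW.
  by rewrite addr_ge0 ?ler0n // pA.
rewrite mulf_eq0 expf_eq0 /= mulf_eq0 invr_eq0 (gt_eqF q0) orbF => /orP[//|].
by rewrite gt_eqF // ltr_wpDr ?ltr0n // pA.
Qed.

(** Since S and T commute, (S + T)(S - T) = S^2 - T^2 = 0, so both forms vanish at y = (S - T) x.
    Then S y = T y = 0, and moving S - T across the inner product gives <y | y> = 0. *)
Lemma sqrt_op_unique (S T : V -> V) : linear S -> linear T ->
  (forall x, 0 <= <(x | S x)>) -> (forall x, 0 <= <(x | T x)>) ->
  S \o S = T \o T -> S \o T = T \o S -> S = T.
Proof.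
move=> lS lT pS pT sq co; apply/funext => x.
pose y := S x - T x.
have Ey : S y + T y = 0.
  rewrite (linear_mapB lS) (linear_mapB lT); have := congr1 (@^~ x) sq; have := congr1 (@^~ x) co => /= -> ->.
  by rewrite addrA subrK subrr.
have E : <(y | S y)> + <(y | T y)> = 0 by rewrite -innerpDr Ey innerp0r.
have /andP[/eqP yS /eqP yT] : (<(y | S y)> == 0) && (<(y | T y)> == 0).
  by rewrite -paddr_eq0 ?pS ?pT //; apply/eqP.
apply/subr0_eq/innerp_eq0; rewrite -/y {1}/y innerpBl.
rewrite (selfadjoint_of_ge0 lS pS) (selfadjoint_of_ge0 lT pT).
by rewrite (positive_op_eq0 lS pS yS) (positive_op_eq0 lT pT yT) subrr.
Qed.

End inner_product.

(** * Orthonormal bases and traces *)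

Lemma closure_normP (K : numFieldType) (W : normedModType K) (A : set W) (x : W) :
  closure A x <-> forall eps : K, 0 < eps -> exists2 y, A y & `|x - y| < eps.
Proof.
split=> [clA eps eps0|H B].
  have /clA[y [Ay By]] : nbhs x (ball x eps) by exact: nbhsx_ballx.
  by exists y => //; move: By; rewrite -ball_normE.
rewrite -nbhs_ballE => -[eps /= eps0 xB].
have [y Ay xy] := H _ eps0; exists y; split=> //; apply: xB.
by rewrite -ball_normE.
Qed.

Section orthonormal_family.
Context {R : realType} {V : hilbertType R} {I : choiceType} (e : I -> V).
Hypothesis orthonormal_e : forall i j, <(e i | e j)> = (i == j)%:R.
Implicit Types (x y : V) (s : seq I).

(** For [s] without repetition, the orthogonal projection of [x] onto the span of the [e i] with [i]
    in [s]. *)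
Definition fourier_sum s x := \sum_(i <- s) <(e i | x)> *: e i.

Lemma fourier_sumB s x y : fourier_sum s (x - y) = fourier_sum s x - fourier_sum s y.
Proof. by rewrite -sumrB; apply: eq_bigr => i _; rewrite innerpBr scalerBl. Qed.

Lemma fourier_sumD s x y : fourier_sum s (x + y) = fourier_sum s x + fourier_sum s y.
Proof. by rewrite -big_split; apply: eq_bigr => i _; rewrite innerpDr scalerDl. Qed.

Lemma coef_lin_comb s (c : I -> R[i]) j : uniq s -> j \in s ->
  <(e j | \sum_(i <- s) c i *: e i)> = c j.
Proof.
move=> us js; rewrite innerp_sumr (bigD1_seq j) //= innerpZr orthonormal_e eqxx mulr1.
by rewrite big1 ?addr0 // => i ij; rewrite innerpZr orthonormal_e eq_sym (negPf ij) mulr0.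
Qed.

Lemma bessel_eq s x : uniq s ->
  `|x - fourier_sum s x| ^+ 2 = `|x| ^+ 2 - \sum_(i <- s) `|<(e i | x)>| ^+ 2.
Proof.
move=> us; rewrite innerp_norm innerpBl !innerpBr -innerp_norm.
have E : <(fourier_sum s x | x)> = \sum_(i <- s) `|<(e i | x)>| ^+ 2.
  by rewrite innerp_suml; apply: eq_bigr => i _; rewrite innerpZl normCK mulrC.
have Er : Num.conj (\sum_(i <- s) `|<(e i | x)>| ^+ 2)
    = \sum_(i <- s) `|<(e i | x)>| ^+ 2.
  by apply: geC0_conj; apply: sumr_ge0 => i _; rewrite exprn_ge0.
rewrite -(innerp_conj (fourier_sum s x) x) E Er.
rewrite {1}/fourier_sum innerp_suml.
suff -> : \sum_(i <- s) <(<(e i | x)> *: e i | fourier_sum s x)>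
  = \sum_(i <- s) `|<(e i | x)>| ^+ 2 by rewrite subrr subr0.
rewrite [LHS]big_seq [RHS]big_seq; apply: eq_bigr => i si.
by rewrite innerpZl coef_lin_comb // normCK mulrC.
Qed.

Lemma fourier_sum_id s t (c : I -> R[i]) : uniq s -> {subset t <= s} ->
  fourier_sum s (\sum_(i <- t) c i *: e i) = \sum_(i <- t) c i *: e i.
Proof.
move=> us; elim: t => [|j t IH] ts.
  by rewrite big_nil /fourier_sum big1 // => i _; rewrite innerp0r scale0r.
rewrite big_cons fourier_sumD IH; last by move=> i it; rewrite ts // inE it orbT.
congr (_ + _).
have js : j \in s by rewrite ts // inE eqxx.
rewrite /fourier_sum (bigD1_seq j) //= big1 ?addr0; last first.
  by move=> i ij; rewrite innerpZr orthonormal_e (negPf ij) mulr0 scale0r.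
by rewrite innerpZr orthonormal_e eqxx mulr1.
Qed.

(** The projection P fixes the combination y, so x - P x = (x - y) - P (x - y), whose norm
    [bessel_eq] bounds by that of x - y. *)
Lemma fourier_sum_best s t (c : I -> R[i]) x : uniq s -> {subset t <= s} ->
  `|x - fourier_sum s x| <= `|x - \sum_(i <- t) c i *: e i|.
Proof.
move=> us ts; set y := \sum_(i <- t) _.
have -> : x - fourier_sum s x = (x - y) - fourier_sum s (x - y).
  by rewrite fourier_sumB fourier_sum_id // opprB addrA subrK.
rewrite -(@ler_pXn2r _ 2) ?nnegrE // bessel_eq // gerBl.
by apply: sumr_ge0 => i _; rewrite exprn_ge0.
Qed.

(** The partial sum over B is [<(x | fourier_sum B y)>], so the error is controlled by the distance
    from y to its projection. Totality supplies a combination close to y, and every B containing its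
    indices does at least as well. *)
Lemma parseval x y : total_family e ->
  partial_sum (fun i => <(x | e i)> * <(e i | y)> : R[i]^o) @ totally
    --> (<(x | y)> : R[i]^o).
Proof.
move=> tot; apply/cvgrPdist_lt => eps eps0.
have x1 : 0 < `|x| + 1 by rewrite ltr_wpDl.
have [_ [t [c ->]] yt] : exists2 z, [set y | exists s (c : I -> R[i]),
    y = \sum_(i <- s) c i *: e i] z & `|y - z| < eps / (`|x| + 1).
  by have /closure_normP := tot y; apply; rewrite divr_gt0.
exists [fset i in t]%fset => //= B tB.
have ts : {subset t <= B}.
  by move=> i it; apply: (fsubsetP tB); rewrite inE.
have -> : partial_sum (fun i => <(x | e i)> * <(e i | y)> : R[i]^o) B
    = <(x | fourier_sum B y)>.
  transitivity (\sum_(i <- B) <(x | e i)> * <(e i | y)>).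
    exact/esym/big_seq_fsetE.
  rewrite innerp_sumr.
  by apply: eq_bigr => i _; rewrite innerpZr mulrC.
rewrite -innerpBr (le_lt_trans (cauchy_schwarz _ _)) //.
apply: (@le_lt_trans _ _ ((`|x| + 1) * `|y - fourier_sum B y|)).
  by rewrite ler_wpM2r // lerDl.
rewrite mulrC -ltr_pdivlMr //; apply: le_lt_trans yt.
by apply: fourier_sum_best => //; exact: fset_uniq.
Qed.

End orthonormal_family.

(** * Traces of rank-one operators *)

Section trace_rank_one.
Context {R : realType} {V : hilbertType R}.
Implicit Types (a b : V).

Definition rank_one a b : V -> V := fun x => <(a | x)> *: b.

Lemma has_trace_rank_one a b : has_trace (rank_one a b) <(a | b)>.
Proof.
move=> I e [oe te]; under eq_fun do rewrite innerpZr.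
exact: parseval.
Qed.

Lemma has_traceD (A B : V -> V) z w : has_trace A z -> has_trace B w ->
  has_trace (fun x => A x + B x) (z + w).
Proof.
move=> tA tB I e be.
rewrite (_ : partial_sum _ = (partial_sum (fun i => <(e i | A (e i))> : R[i]^o))
   \+ (partial_sum (fun i => <(e i | B (e i))> : R[i]^o))).
  by apply: cvgD; [exact: tA|exact: tB].
apply/funext => F /=; rewrite /partial_sum -big_split /=.
by apply: eq_bigr => i _; rewrite innerpDr.
Qed.

(** In the absence of an orthonormal basis [has_trace] would hold of every value, so one is supplied
    to make the limit unique. *)
Lemma traceE (I : choiceType) (e : I -> V) (A : V -> V) z :
  orthonormal_basis e -> has_trace A z -> trace A = z.
Proof.
move=> be tA; rewrite /trace; case: xgetP => [w _ tw|/(_ z)//].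
by apply: cvg_unique (tw _ _ be) (tA _ _ be); exact: norm_hausdorff.
Qed.

End trace_rank_one.

(** * Bounded operators, projections and the overlap of two vectors *)

Section operators.
Context {R : realType} {V : hilbertType R}.
Implicit Types (a b x y psi : V) (A B : V -> V).

Lemma bounded_opP A (M : R[i]) : linear A -> 0 <= M ->
  (forall x, `|A x| <= M * `|x|) -> bounded_op A.
Proof.
move=> lA M0 bA; split=> // x; apply/cvgrPdist_lt => eps eps0.
have M1 : 0 < M + 1 by rewrite ltr_wpDl.
have r0 : 0 < eps / (M + 1) by rewrite divr_gt0.
apply/nbhs_ballP; exists (eps / (M + 1)) => //= y; rewrite -ball_normE /= => xy.
rewrite -(linear_mapB lA) (le_lt_trans (bA _)) //.
apply: (@le_lt_trans _ _ ((M + 1) * `|x - y|)).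
  by rewrite ler_wpM2r // lerDl.
by rewrite mulrC -ltr_pdivlMr.
Qed.

Lemma bounded_op_rank_one a b : bounded_op (rank_one a b).
Proof.
apply: (@bounded_opP _ (`|a| * `|b|)) => [c x y||x]; last 1 first.
- by rewrite normrZ mulrAC ler_wpM2r // cauchy_schwarz.
- by rewrite /rank_one innerpDr innerpZr scalerDl scalerA.
- by rewrite mulr_ge0.
Qed.

Lemma bounded_opD A B : bounded_op A -> bounded_op B ->
  bounded_op (fun x => A x + B x).
Proof.
move=> [lA cA] [lB cB]; split => [c x y|x]; last by apply: cvgD; [exact: cA|exact: cB].
by rewrite lA lB scalerDr addrACA.
Qed.

Lemma bounded_opB A B : bounded_op A -> bounded_op B ->
  bounded_op (fun x => A x - B x).
Proof.
move=> [lA cA] [lB cB]; split => [c x y|x]; last by apply: cvgB; [exact: cA|exact: cB].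
by rewrite lA lB scalerBr opprD addrACA.
Qed.

Lemma positive_op_ketbra psi : positive_op (ketbra psi).
Proof.
split=> [|x]; first exact: bounded_op_rank_one.
by rewrite innerpZr -innerp_conj mulrC -normCK exprn_ge0.
Qed.

Lemma positive_op_subr_ketbra psi : `|psi| = 1 ->
  positive_op (fun x => x - ketbra psi x).
Proof.
move=> psi1; split=> [|x].
  apply: bounded_opB; last exact: bounded_op_rank_one.
  by split=> // x; exact: cvg_id.
rewrite innerpBr innerpZr subr_ge0 -(innerp_conj psi) -normCK -innerp_norm.
by rewrite ler_pXn2r ?nnegrE // (le_trans (cauchy_schwarz _ _)) // psi1 mul1r.
Qed.

(** The real part only moves the squared modulus, which lives in [R[i]], to [R]. *)
Definition overlap psi0 psi : R := complex.Re (`|<(psi0 | psi)>| ^+ 2).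

Lemma overlapE psi0 psi : ((overlap psi0 psi)%:C)%C = `|<(psi0 | psi)>| ^+ 2.
Proof. by rewrite RRe_real // ger0_real // exprn_ge0. Qed.

Lemma overlap_le1 psi0 psi : `|psi0| = 1 -> `|psi| = 1 -> overlap psi0 psi <= 1.
Proof.
by move=> p0 p1; rewrite -lecR overlapE expr_le1 // innerp_le1.
Qed.

End operators.

Lemma mulVf_sqr (F : fieldType) (x : F) : x^-1 * x ^+ 2 = x.
Proof.
have [->|x0] := eqVneq x 0; first by rewrite expr0n mulr0.
by rewrite expr2 mulKf.
Qed.

(* [v] is the component of [psi] orthogonal to [psi0], of norm [l]. The square of
   A = |psi><psi| - |psi0><psi0| is l^2 times the projection onto their span, so
   |A| = l |psi0><psi0| + l^-1 |v><v|; at [l = 0] the convention [0^-1 = 0] is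
   harmless because then [v = 0]. *)
Section abs_difference.
Context {R : realType} {V : hilbertType R} (psi0 psi v : V) (c l : R[i]).
Hypotheses (psi00 : <(psi0 | psi0)> = 1) (psiE : psi = v + c *: psi0).
Hypotheses (psi0v : <(psi0 | v)> = 0) (vv : <(v | v)> = l ^+ 2).
Hypotheses (lsq : l ^+ 2 = 1 - c * Num.conj c) (l_ge0 : 0 <= l).

Let A (x : V) := ketbra psi x - ketbra psi0 x.
Let T (x : V) := rank_one psi0 (l *: psi0) x + rank_one v (l^-1 *: v) x.

Let vpsi0 : <(v | psi0)> = 0.
Proof. by rewrite -innerp_conj psi0v rmorph0. Qed.

Let v_eq0 : l = 0 -> v = 0.
Proof. by move=> l0; apply: innerp_eq0; rewrite vv l0 expr0n. Qed.

Let AE x : A x = (<(v | x)> + Num.conj c * <(psi0 | x)>) *: v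
  + (c * <(v | x)> - l ^+ 2 * <(psi0 | x)>) *: psi0.
Proof.
rewrite /A /ketbra psiE innerpDl innerpZl scalerDr scalerA -addrA -scalerBl.
by congr (_ + _ *: _); rewrite lsq; ring.
Qed.

Let AAE x : A (A x) = <(v | x)> *: v + (l ^+ 2 * <(psi0 | x)>) *: psi0.
Proof.
rewrite [LHS]AE AE !(innerpDr, innerpZr) vv psi0v vpsi0 psi00 lsq.
by congr (_ *: _ + _ *: _); ring.
Qed.

Let TTE x : T (T x) = <(v | x)> *: v + (l ^+ 2 * <(psi0 | x)>) *: psi0.
Proof.
rewrite /T /rank_one !(innerpDr, innerpZr) vv psi0v vpsi0 psi00 !scalerA addrC.
have [l0|l0] := eqVneq l 0.
  by rewrite (v_eq0 l0) !scaler0 l0 expr0n !(mul0r, mulr0, scale0r, add0r).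
rewrite !(mulr0, mulr1, addr0, add0r) mulVf_sqr mulfK //.
by rewrite -[in X in _ = _ + X]mulrC expr2 mulrA.
Qed.

(** As a multiple of A^2, [T] commutes with every linear square root of A^2, which [sqrt_op_unique]
    requires. *)
Let TA x : T x = l^-1 *: A (A x).
Proof.
rewrite AAE scalerDr !scalerA /T /rank_one !scalerA addrC.
have [l0|l0] := eqVneq l 0.
  by rewrite (v_eq0 l0) !scaler0 l0 invr0 !(mul0r, mulr0, scale0r, add0r).
by rewrite mulrA mulVf_sqr [l^-1 * _]mulrC [l * _]mulrC.
Qed.

Let T_bounded : bounded_op T.
Proof. by apply: bounded_opD; exact: bounded_op_rank_one. Qed.

Let T_ge0 x : 0 <= <(x | T x)>.
Proof.
rewrite innerpDr !innerpZr addr_ge0 //.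
  rewrite mulrCA mulr_ge0 // -(innerp_conj x) mulrC -normCK.
  by rewrite exprn_ge0.
rewrite mulrCA mulr_ge0 ?invr_ge0 // -(innerp_conj x) mulrC -normCK.
by rewrite exprn_ge0.
Qed.

Let A_adjoint : adjoint_of A A.
Proof.
move=> x y; rewrite /A /ketbra innerpBl innerpBr !innerpZl !innerpZr !innerp_conj.
by rewrite ![<(x|_)> * _]mulrC.
Qed.

Lemma abs_op_diff_ketbra : abs_op (fun x => ketbra psi x - ketbra psi0 x) = T.
Proof.
have TT : T \o T = A \o A by apply/funext => x /=; rewrite TTE AAE.
rewrite /abs_op; case: xgetP => [S _ /= [pS [B adjB SB]]|/(_ T)[]]; last first.
  by split; [split|exists A].
(* Adjoints are unique, so the [B] attached to the chosen root [S] is [A] itself. *)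
have BA : B = A.
  apply/funext => x; apply: innerp_ext => z.
  by rewrite -(innerp_conj _ z) adjB -A_adjoint innerp_conj.
have [[lS _] pS'] := pS; have [lT _] := T_bounded.
have SS x : A (A x) = S (S x).
  by have := congr1 (@^~ x) SB; rewrite BA.
apply: sqrt_op_unique => //; first by rewrite SB BA -TT.
by apply/funext => x /=; rewrite !TA (linear_mapZ lS) !SS.
Qed.

Lemma trace_abs_op_diff_ketbra (I : choiceType) (e : I -> V) :
  orthonormal_basis e ->
  trace (abs_op (fun x => ketbra psi x - ketbra psi0 x)) = 2 * l.
Proof.
move=> be; rewrite abs_op_diff_ketbra.
have tT := @has_traceD _ _ _ _ _ _ (@has_trace_rank_one _ _ psi0 (l *: psi0))
  (@has_trace_rank_one _ _ v (l^-1 *: v)).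
rewrite (traceE be tT) !innerpZr psi00 vv mulr1.
by rewrite mulVf_sqr mulr_natl.
Qed.

End abs_difference.

(** The preceding computation with c = <psi0 | psi>, v = psi - c psi0 and l = sqrt (1 - |c|^2). *)
Lemma trace_norm_diff_ketbra (R : realType) (V : hilbertType R) (I : choiceType)
    (e : I -> V) (psi0 psi : V) :
  orthonormal_basis e -> `|psi0| = 1 -> `|psi| = 1 ->
  trace_norm (fun x => ketbra psi x - ketbra psi0 x)
    = 2 * Num.sqrt (1 - overlap psi0 psi).
Proof.
move=> be psi0_norm psi_norm.
have psi00 := innerp_unit psi0_norm.
set lam := Num.sqrt _; pose c := <(psi0 | psi)>.
have lsq : (lam%:C)%C ^+ 2 = 1 - c * Num.conj c.
  rewrite -normCK -overlapE -rmorphXn /= sqr_sqrtr ?subr_ge0 ?overlap_le1 //.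
  by rewrite rmorphB.
have psi0v : <(psi0 | psi - c *: psi0)> = 0.
  by rewrite innerpBr innerpZr psi00 mulr1 subrr.
rewrite /trace_norm (@trace_abs_op_diff_ketbra _ _ _ _ (psi - c *: psi0) c
   (lam%:C)%C psi00 _ psi0v _ lsq _ _ _ be).
- by rewrite -(rmorph_nat (real_complex R)) -rmorphM.
- by rewrite subrK.
- rewrite innerpBl innerpZl psi0v mulr0 subr0 innerpBr innerpZr lsq.
  by rewrite -innerp_norm psi_norm expr1n -(innerp_conj psi0 psi).
- by rewrite ler0c sqrtr_ge0.
Qed.

Lemma separatedP (R : realType) (V : hilbertType R) (I : choiceType) (e : I -> V)
    (psi0 psi : V) (phi : R) :
  orthonormal_basis e -> `|psi0| = 1 -> `|psi| = 1 -> 0 <= phi ->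
  Defs.separated (ketbra psi0) phi (ketbra psi) <-> overlap psi0 psi <= 1 - phi ^+ 2 / 4.
Proof.
move=> be psi0_norm psi_norm phi0.
have s0 : 0 <= 1 - overlap psi0 psi by rewrite subr_ge0 overlap_le1.
rewrite /Defs.separated /=  (trace_norm_diff_ketbra be) //.
rewrite -(ler_pXn2r (_ : 0 < 2)%N) ?nnegrE // ?mulr_ge0 ?sqrtr_ge0 //.
rewrite exprMn sqr_sqrtr //; split=> [[_ H]|H]; first by clear -H; lra.
by split; [exists psi|clear -H; lra].
Qed.

(** * Tensor powers *)

Section total_families.
Context {R : realType} {V : hilbertType R}.

(** A nonzero d = x - y would be orthogonal to all combinations of the family, hence at distance at
    least |d| from each. *)
Lemma innerp_total_ext (I : Type) (e : I -> V) x y : total_family e ->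
  (forall i, <(e i | x)> = <(e i | y)>) -> x = y.
Proof.
move=> te E; apply/subr0_eq/eqP; rewrite -normr_eq0; apply/negPn/negP => d0.
have ed i : <(e i | x - y)> = 0 by rewrite innerpBr E subrr.
move: (x - y) ed d0 => d ed d0; have dp : 0 < `|d| by rewrite lt_def d0 normr_ge0.
have /closure_normP/(_ _ dp)[_ [s [c ->]]] := te d.
apply/negP; rewrite -real_leNgt ?normr_real // -(ler_pM2l dp).
apply: le_trans (cauchy_schwarz _ _).
rewrite innerpBr innerp_sumr [X in _ - X]big1 ?subr0 => [|i _].
  by rewrite ger0_norm ?innerp_ge0 // -innerp_norm expr2.
by rewrite innerpZr -innerp_conj ed rmorph0 mulr0.
Qed.

(** The kernel of the continuous map A - B is closed and contains the combinations of the family,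
    which are dense. *)
Lemma bounded_op_total_ext (I : Type) (e : I -> V) (A B : V -> V) :
  total_family e -> bounded_op A -> bounded_op B ->
  (forall i, A (e i) = B (e i)) -> A = B.
Proof.
move=> te bA bB E; have [lD cD] := bounded_opB bA bB.
set D := fun x => A x - B x in lD cD.
apply/funext => x; apply: subr0_eq; rewrite -/(D x).
have : closed (D @^-1` [set 0]).
  apply: preimage_closed => [z _|]; first exact: cD.
  exact/accessible_closed_set1/hausdorff_accessible/norm_hausdorff.
rewrite closure_id => /esym D0c.
suff : (D @^-1` [set 0]) x by [].
rewrite -D0c; apply: closure_subset (te x) => _ [s [c ->]] /=.
elim: s => [|i s IH]; first by rewrite big_nil (linear_map0 lD).
by rewrite big_cons lD IH /D E subrr scaler0 addr0.
Qed.

Lemma total_familyP (I : Type) (e : I -> V) : total_family e <->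
  forall x eps, 0 < eps -> exists s (c : I -> R[i]),
    `|x - \sum_(i <- s) c i *: e i| < eps.
Proof.
split=> [te x eps eps0|H x].
  by have /closure_normP/(_ _ eps0)[_ [s [c ->]]] := te x; exists s, c.
apply/closure_normP => eps /(H x)[s [c sc]].
by exists (\sum_(i <- s) c i *: e i) => //; exists s, c.
Qed.

End total_families.

(** Coefficients depend on the index, not on the position in the list, so repeated indices are
    merged with their multiplicities. *)
Lemma lin_comb_cat (K : pzRingType) (W : lmodType K) (I : eqType) (e : I -> W)
    (s t : seq I) (c d : I -> K) : exists (r : seq I) (b : I -> K),
  \sum_(i <- s) c i *: e i + \sum_(i <- t) d i *: e i = \sum_(i <- r) b i *: e i.
Proof.
pose b i := (count_mem i s)%:R * c i + (count_mem i t)%:R * d i.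
have E (u : seq I) (f : I -> K) r : uniq r -> {subset u <= r} ->
    \sum_(i <- u) f i *: e i = \sum_(i <- r) ((count_mem i u)%:R * f i) *: e i.
  move=> ur; elim: u => [|j u IH] sr.
    by rewrite big_nil big1 // => i _; rewrite mul0r scale0r.
  have jr : j \in r by rewrite sr // inE eqxx.
  rewrite big_cons IH; last by move=> i iu; rewrite sr // inE iu orbT.
  under [RHS]eq_bigr => i _ do rewrite /= natrD mulrDl scalerDl.
  rewrite big_split /= [in RHS](bigD1_seq j) //= eqxx mul1r.
  by rewrite [X in _ + X + _]big1 ?addr0 // => i /negPf ij; rewrite eq_sym ij mul0r scale0r.
exists (undup (s ++ t)), b.
rewrite (E s c (undup (s ++ t))) ?undup_uniq //; last first.
  by move=> i si; rewrite mem_undup mem_cat si.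
rewrite (E t d (undup (s ++ t))) ?undup_uniq //; last first.
  by move=> i ti; rewrite mem_undup mem_cat ti orbT.
by rewrite -big_split /=; apply: eq_bigr => i _; rewrite -scalerDl.
Qed.

Lemma total_family_trans (R : realType) (V : hilbertType R) (J : Type)
    (I : eqType) (t : J -> V) (e : I -> V) :
  total_family t ->
  (forall j eps, 0 < eps -> exists s (c : I -> R[i]),
    `|t j - \sum_(i <- s) c i *: e i| < eps) ->
  total_family e.
Proof.
move=> /total_familyP tt te; apply/total_familyP => x eps eps0.
(* The closed span of [e]: a linear subspace that contains every [t j]. *)
pose adh y := forall eps : R[i], 0 < eps -> exists s (c : I -> R[i]),
  `|y - \sum_(i <- s) c i *: e i| < eps.
have adhZ a y : adh y -> adh (a *: y).
  move=> ay d d0; have a1 : 0 < `|a| + 1 by rewrite ltr_wpDl.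
  have [|s [c sc]] := ay (d / (`|a| + 1)); first by rewrite divr_gt0.
  exists s, (fun i => a * c i); under eq_bigr do rewrite -scalerA.
  rewrite -scaler_sumr -scalerBr normrZ.
  apply: (@le_lt_trans _ _ ((`|a| + 1) * `|y - \sum_(i <- s) c i *: e i|)).
    by rewrite ler_wpM2r // lerDl.
  by rewrite mulrC -ltr_pdivlMr.
have adhD y z : adh y -> adh z -> adh (y + z).
  move=> ay az d d0; have d2 : 0 < d / 2 by rewrite divr_gt0 // ltr0n.
  have [s [c sc]] := ay _ d2; have [s' [c' sc']] := az _ d2.
  have [r [b E]] := lin_comb_cat e s s' c c'; exists r, b; rewrite -E.
  rewrite opprD addrACA (le_lt_trans (ler_normD _ _)) //.
  by rewrite [d]splitr ltrD.
have adh0 : adh 0 by move=> d d0; exists [::], (fun=> 0); rewrite big_nil subr0 normr0.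
have eps2 : 0 < eps / 2 by rewrite divr_gt0 // ltr0n.
have [s [c sc]] := tt x _ eps2.
have : adh (\sum_(j <- s) c j *: t j).
  elim: (s) => [|j s' IH]; first by rewrite big_nil.
  by rewrite big_cons; apply: adhD IH; exact/adhZ/te.
move=> /(_ _ eps2)[s' [c' sc']]; exists s', c'.
rewrite [eps]splitr -(subrK (\sum_(j <- s) c j *: t j) x) -addrA.
by rewrite (le_lt_trans (ler_normD _ _)) // ltrD.
Qed.

Section tensor.
Context {R : realType} {V : hilbertType R} {n : nat} (K : tensor_power V n).

(** Turns identities between vectors of [K] into identities between products of scalars. *)
Lemma tens_ext (x y : K) : (forall w, <(tens K w | x)> = <(tens K w | y)>) -> x = y.
Proof. exact/innerp_total_ext/tens_total. Qed.

Lemma tensZ (c : 'I_n -> R[i]) (u : 'I_n -> V) :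
  tens K (fun i => c i *: u i) = (\prod_i c i) *: tens K u.
Proof.
apply: tens_ext => w; rewrite innerpZr !tens_innerp -big_split.
by apply: eq_bigr => i _; rewrite innerpZr.
Qed.

Lemma norm_tens_const (u : V) : `|u| = 1 -> `|tens K (fun=> u)| = 1.
Proof.
move=> u1; apply/eqP; rewrite -(@eqrXn2 _ 2) // expr1n innerp_norm tens_innerp.
by rewrite -innerp_norm u1 expr1n big1.
Qed.

(** The projection onto the power vector acts as required on product vectors, and totality leaves no
    other bounded operator. *)
Lemma op_power_ketbra (psi : V) :
  @op_power R V n K (ketbra psi) = ketbra (tens K (fun=> psi)).
Proof.
have E u : ketbra (tens K (fun=> psi)) (tens K u) = tens K (fun i => ketbra psi (u i)).
  by rewrite tensZ /ketbra tens_innerp.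
rewrite /op_power; case: xgetP => [B _ [bB BE]|/(_ (ketbra (tens K (fun=> psi))))[]].
  apply: bounded_op_total_ext (@tens_total _ _ _ K) bB _ _ => [|u].
    exact: bounded_op_rank_one.
  by rewrite BE E.
by split=> //; exact: bounded_op_rank_one.
Qed.

(** * The product basis, which gives traces on the tensor power a unique value *)

Section tensor_basis.
Variable e : nat -> V.
Hypothesis e_basis : orthonormal_basis e.

Definition tens_basis (f : {ffun 'I_n -> nat}) : K := tens K (fun i => e (f i)).

Lemma tens_basis_orthonormal f g : <(tens_basis f | tens_basis g)> = (f == g)%:R.
Proof.
have [oe _] := e_basis; rewrite tens_innerp; under eq_bigr do rewrite oe.
have [->|fg] := eqVneq f g; first by rewrite big1 // => i _; rewrite eqxx.
have [i fgi] : exists i, f i != g i.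
  apply/existsP; rewrite -negb_forall; apply: contra fg => /forallP fg.
  by apply/eqP/ffunP => i; apply/eqP.
by rewrite (bigD1 i) //= (negPf fgi) mul0r.
Qed.

Definition tens_box N : seq {ffun 'I_n -> nat} :=
  [seq [ffun i => val (g i)] | g : {ffun 'I_n -> 'I_N}].

Lemma tens_box_uniq N : uniq (tens_box N).
Proof.
rewrite map_inj_uniq ?enum_uniq // => g h /ffunP E; apply/ffunP => i.
by apply/val_inj; have := E i; rewrite !ffunE.
Qed.

(** Distributivity: the sum over the cube {0, ..., N-1}^n factors into n one-dimensional sums. *)
Lemma sum_tens_box N (u : 'I_n -> V) :
  \sum_(f <- tens_box N) `|<(tens_basis f | tens K u)>| ^+ 2
    = \prod_i \sum_(j < N) `|<(e j | u i)>| ^+ 2.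
Proof.
rewrite big_map big_enum /= bigA_distr_bigA /=; apply: eq_bigr => g _.
rewrite tens_innerp normr_prod -prodrXl; apply: eq_bigr => i _.
by rewrite ffunE.
Qed.

Lemma parseval_seq (x : V) :
  (\sum_(j < N) `|<(e j | x)>| ^+ 2 : R[i]^o) @[N --> \oo] --> (`|x| ^+ 2 : R[i]^o).
Proof.
have [oe te] := e_basis; have P := @parseval _ _ _ _ oe x x te.
rewrite innerp_norm.
(* Initial segments eventually contain any given finite set, so the unconditional limit is also the
   limit along them. *)
have F : ([fset j in iota 0 N])%fset @[N --> \oo] --> (@totally nat).
  move=> A [B _ BA]; exists (\max_(i <- B) i.+1)%N => // N /= BN; apply: BA => /=.
  apply/fsubsetP => i iB; rewrite !inE mem_iota /= add0n.
  by apply: leq_trans BN; rewrite (big_rem i) //= leq_max leqnn.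
have := cvg_comp _ _ F P; apply: cvg_trans; apply: near_eq_cvg.
near=> N => /=.
transitivity (\sum_(j <- [fset j in iota 0 N]%fset) <(x | e j)> * <(e j | x)>).
  exact/esym/big_seq_fsetE.
rewrite -(big_mkord xpredT (fun j => `|<(e j | x)>| ^+ 2)) /index_iota subn0.
rewrite (perm_big (iota 0 N)) /=.
  by apply: eq_bigr => j _; rewrite normr_innerp mulrC.
apply: uniq_perm; rewrite ?iota_uniq ?fset_uniq // => j; by rewrite inE.
Unshelve. all: by end_near. Qed.

(** It is enough to approximate product vectors. By [bessel_eq] the squared error over the box is
    the squared norm minus a product of partial Parseval sums, which tends to 0. *)
Lemma tens_basis_total : total_family tens_basis.
Proof.
apply: total_family_trans (@tens_total _ _ _ K) _ => u eps eps0.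
have : (\prod_i \sum_(j < N) `|<(e j | u i)>| ^+ 2 : R[i]^o) @[N --> \oo]
    --> (`|tens K u| ^+ 2 : R[i]^o).
  rewrite innerp_norm tens_innerp.
  apply: cvg_big => [z|i _]; first exact: mul_continuous.
  by rewrite -innerp_norm; exact: parseval_seq.
move=> /cvgrPdist_lt/(_ (eps ^+ 2)); rewrite exprn_gt0 // => /(_ isT).
case=> N _ /(_ N (leqnn N)) /=; rewrite -sum_tens_box.
rewrite -(bessel_eq tens_basis_orthonormal) ?tens_box_uniq //.
rewrite ger0_norm ?exprn_ge0 // ltr_pXn2r ?nnegrE ?(ltW eps0) // => H.
by exists (tens_box N), (fun f => <(tens_basis f | tens K u)>).
Qed.

Lemma tens_basis_basis : orthonormal_basis tens_basis.
Proof. by split; [exact: tens_basis_orthonormal|exact: tens_basis_total]. Qed.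

End tensor_basis.
End tensor.

(** * The minimax error *)

(** In characteristic 0 the polynomial X^n - 1 is separable, so there are n distinct n-th roots of
    unity, among them a primitive one. *)
Lemma closed_prim_root_exists (C : numClosedFieldType) n : (0 < n)%N ->
  exists z : C, n.-primitive_root z.
Proof.
move=> n0; have [rs] := closed_field_poly_normal ('X^n - 1 : {poly C}).
rewrite (monicP _) ?monicXnsubC // scale1r => Ers.
have rs1 : all n.-unity_root rs.
  by apply/allP => z zrs; rewrite /root_of_unity Ers root_prod_XsubC.
have rsU : uniq rs.
  by rewrite -separable_prod_XsubC -Ers separable_Xn_sub_1 // pnatr_eq0 -lt0n.
have : (n <= size rs)%N.
  by rewrite -ltnS -(size_prod_XsubC rs id) -Ers size_XnsubC.
by move=> /(has_prim_root n0 rs1 rsU)/hasP[z _ zP]; exists z.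
Qed.

(** A geometric sum of ratio w^k, which differs from 1 while its N-th power is 1. *)
Lemma sum_prim_root_expr (F : fieldType) N (w : F) k :
  N.-primitive_root w -> (0 < k < N)%N -> \sum_(j < N) w ^+ (j * k) = 0.
Proof.
move=> wP /andP[k0 kN]; have wk1 : w ^+ k != 1.
  by rewrite -(prim_order_dvd wP) gtnNdvd.
have : (w ^+ k - 1) * \sum_(j < N) (w ^+ k) ^+ j = 0.
  by rewrite -subrX1 exprAC (prim_expr_order wP) expr1n subrr.
move=> /eqP; rewrite mulf_eq0 subr_eq0 (negPf wk1) => /eqP {2}<-.
by apply: eq_bigr => j _; rewrite mulnC exprM.
Qed.

(* The product is a polynomial of degree at most n in w^j, and averaging over the
   (n+1)-th roots of unity leaves only its constant coefficient. *)
Lemma sum_prod_prim_root (F : fieldType) n (w : F) (a b : 'I_n -> F) :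
  n.+1.-primitive_root w ->
  \sum_(j < n.+1) \prod_i (a i + w ^+ j * b i) = n.+1%:R * \prod_i a i.
Proof.
move=> wP; pose p := \prod_i ((a i)%:P + b i *: 'X).
have sp : (size p <= n.+1)%N.
  apply: leq_trans (size_prod_leq _ _) _; rewrite card_ord.
  rewrite leq_subLR addnS ltnS addnn -mul2n mulnC.
  have H (i : 'I_n) : (size ((a i)%:P + b i *: 'X)%R <= 2)%N.
    rewrite (leq_trans (size_polyD _ _)) // geq_max (leq_trans (size_polyC_leq1 _)) //.
    by rewrite (leq_trans (size_scale_leq _ _)) // size_polyX.
  by apply: leq_trans (leq_sum _ (fun i _ => H i)) _; rewrite sum_nat_const card_ord.
have pE z : p.[z] = \prod_i (a i + z * b i).
  by rewrite horner_prod; apply: eq_bigr => i _; rewrite !hornerE mulrC.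
transitivity (\sum_(j < n.+1) \sum_(k < n.+1) p`_k * (w ^+ j) ^+ k).
  by apply: eq_bigr => j _; rewrite -(horner_coef_wide _ sp) pE.
rewrite exchange_big big_ord_recl /= [X in _ + X]big1 ?addr0 => [|k _].
  under eq_bigr do rewrite expr0 mulr1.
  rewrite sumr_const card_ord -horner_coef0 pE.
  by rewrite mulr_natl; congr (_ *+ _); apply: eq_bigr => i _; rewrite mul0r addr0.
rewrite -mulr_sumr; under eq_bigr do rewrite -exprM.
by rewrite (sum_prim_root_expr wP) ?mulr0 //= /bump /= add1n ltnS ltn_ord.
Qed.

(** Expand the nonnegative sum of the [<(u j - d | M (u j - d))>]: as [d] is the mean, all but the
    sum of the [<(u j | M (u j))>] collapses to - N <d | M d>. *)
Lemma positive_op_jensen (R : realType) (V : hilbertType R) (M : V -> V) N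
    (u : 'I_N -> V) (d : V) :
  positive_op M -> \sum_j u j = N%:R *: d ->
  N%:R * <(d | M d)> <= \sum_j <(u j | M (u j))>.
Proof.
move=> [[lM _] pM] ud; rewrite -subr_ge0.
have sa := selfadjoint_of_ge0 lM pM.
have : 0 <= \sum_j <(u j - d | M (u j - d))> by apply: sumr_ge0.
have E j : <(u j - d | M (u j - d))>
    = <(u j | M (u j))> + (- <(u j | M d)> - <(M d | u j)> + <(d | M d)>).
  rewrite (linear_mapB lM) innerpBl !innerpBr (sa d (u j)) opprB -!addrA.
  by congr (_ + (_ + _)); rewrite addrC.
under eq_bigr do rewrite E.
rewrite big_split /= big_split /= big_split /= !sumrN -innerp_suml -innerp_sumr ud.
rewrite innerpZl innerpZr rmorph_nat sumr_const card_ord (sa d d).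
by rewrite !mulr_natl subrK.
Qed.

(** * Upper and lower bounds for the minimax error *)

Section error.
Context {R : realType} {V : hilbertType R} {n : nat} (K : tensor_power V n).
Variables (e : nat -> V) (alpha L : R).
Hypothesis e_basis : orthonormal_basis e.

(** As [M] is self-adjoint, |Psi><Psi| M is the rank-one operator |Psi><M Psi|. *)
Lemma trace_op_power_comp (psi : V) (M : K -> K) : positive_op M ->
  trace (@op_power R V n K (ketbra psi) \o M)
    = <(tens K (fun=> psi) | M (tens K (fun=> psi)))>.
Proof.
move=> [[lM _] pM]; set Psi := tens K _.
have E : op_power (ketbra psi) \o M = rank_one (M Psi) Psi.
  apply/funext => x; rewrite /= op_power_ketbra /ketbra /rank_one.
  by rewrite (selfadjoint_of_ge0 lM pM).
rewrite E (traceE (tens_basis_basis K e_basis) (@has_trace_rank_one _ _ _ _)).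
by rewrite (selfadjoint_of_ge0 lM pM).
Qed.

Lemma binary_povm_le1 (M : (K -> K) * (K -> K)) Psi : binary_povm M ->
  `|Psi| = 1 -> <(Psi | M.1 Psi)> <= 1.
Proof.
move=> [_ [_ p2] M12] P1; rewrite -[leRHS](expr1n _ 2) -P1 innerp_norm.
by rewrite -{3}(M12 Psi) innerpDr lerDl.
Qed.

Variables (psi0 : V) (phi : R).
Hypotheses (psi0_norm : `|psi0| = 1) (phi_ge0 : 0 <= phi) (phi_le2 : phi <= 2).

Let alternative := hermite_sobolev e alpha L `&` Defs.separated (ketbra psi0) phi.

Let pow_ge0 : 0 <= 1 - phi ^+ 2 / 4.
Proof. by move: phi_ge0 phi_le2 => ? ?; nra. Qed.

Lemma alternativeP rho : alternative rho ->
  exists psi, [/\ `|psi| = 1, rho = ketbra psi & overlap psi0 psi <= 1 - phi ^+ 2 / 4].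
Proof.
move=> [_ sep]; have [[psi psi1 E] _] := sep; exists psi; split=> //.
by apply/(separatedP e_basis) => //; rewrite -E.
Qed.

(** Boundedness makes the supremum in the total error a genuine upper bound. *)
Lemma alternative_errors_ub (M : (K -> K) * (K -> K)) : binary_povm M ->
  ubound [set complex.Re (trace (@op_power R V n K rho \o M.1)) | rho in alternative] 1.
Proof.
move=> Mp _ [_ /alternativeP[psi [psi1 -> _]] <-].
have [p1 _ _] := Mp; rewrite trace_op_power_comp //.
exact/(Re_le (binary_povm_le1 Mp (norm_tens_const K psi1))).
Qed.

Lemma minimax_error_le :
  minimax_error K e alpha L (ketbra psi0) phi <= (1 - phi ^+ 2 / 4) ^+ n.
Proof.
set Psi0 := tens K (fun=> psi0).
have P1 : `|Psi0| = 1 by exact: norm_tens_const.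
pose M : (K -> K) * (K -> K) := (ketbra Psi0, fun x => x - ketbra Psi0 x).
have Mp : binary_povm M.
  split=> [||x /=]; [exact: positive_op_ketbra|exact: positive_op_subr_ketbra|].
  by rewrite addrC subrK.
apply: (@le_trans _ _ (total_error e alpha L (ketbra psi0) phi M)).
  (* The infimum lies below the error of [M] once 0 is shown to bound all total errors from
     below. *)
  apply: ge_inf; last by exists M.
  exists 0 => _ [N Np <-]; have [p1 p2 _] := Np.
  rewrite /total_error addr_ge0 //.
    by rewrite trace_op_power_comp //; apply: Re_ge0; apply: p2.2.
  have [->|/set0P[r [rho arho Er]]] := eqVneq
    [set complex.Re (trace (@op_power R V n K rho \o N.1)) | rho in alternative] set0.
    by rewrite sup0.
  have [psi [psi1 Erho _]] := alternativeP arho.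
  apply: (@le_trans _ _ r).
    by rewrite -Er Erho trace_op_power_comp //; apply: Re_ge0; apply: p1.2.
  apply: ub_le_sup; last by exists rho.
  by exists 1; exact: alternative_errors_ub.
have [p1 p2 _] := Mp.
rewrite /total_error trace_op_power_comp // /= /ketbra.
(* The error of the first kind vanishes: the complement of the projection kills [Psi0]. *)
rewrite -innerp_norm P1 expr1n scale1r subrr innerp0r add0r.
have [->|/set0P S0] := eqVneq
    [set complex.Re (trace (@op_power R V n K rho \o ketbra Psi0)) | rho in alternative] set0.
  by rewrite sup0 exprn_ge0.
apply: ge_sup => // _ [rho /alternativeP[psi [psi1 -> le_ov]] <-].
rewrite trace_op_power_comp; last exact: p1.
rewrite innerpZr -normr_innerp tens_innerp prodr_const card_ord normrX.
rewrite exprAC -overlapE -rmorphXn /=.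
by rewrite lerXn2r ?nnegrE // -lecR overlapE exprn_ge0.
Qed.

Lemma minimax_error_ge (v : V) (r : R) : 0 <= r <= 1 ->
  (forall z, `|z| = 1 -> alternative (ketbra ((r%:C)%C *: psi0 + z *: v))) ->
  (r ^+ 2) ^+ n <= minimax_error K e alpha L (ketbra psi0) phi.
Proof.
move=> /andP[r0 r1] alt.
set Psi0 := tens K (fun=> psi0).
have P1 : `|Psi0| = 1 by exact: norm_tens_const.
have [w wP] := @closed_prim_root_exists R[i] _ (ltn0Sn n).
have w1 j : `|w ^+ j| = 1.
  have : `|w| ^+ n.+1 = 1 by rewrite -normrX (prim_expr_order wP) normr1.
  by move=> /eqP; rewrite pexpr_eq1 // normrX => /eqP ->; rewrite expr1n.
pose psi j := (r%:C)%C *: psi0 + w ^+ j *: v.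
pose Psi (j : 'I_n.+1) := tens K (fun=> psi j).
pose D := tens K (fun=> (r%:C)%C *: psi0).
(* Tested against [tens K u], this is [sum_prod_prim_root] with a_i = <u_i | r psi0> and b_i = <u_i
   | v>. *)
have sumPsi : \sum_j Psi j = n.+1%:R *: D.
  apply: tens_ext => u; rewrite innerp_sumr innerpZr tens_innerp.
  rewrite -(@sum_prod_prim_root _ _ w _ (fun i => <(u i | v)>)) //.
  apply: eq_bigr => j _; rewrite tens_innerp; apply: eq_bigr => i _.
  by rewrite innerpDr [in X in _ + X]innerpZr.
apply: lb_le_inf.
  (* The test that always accepts shows that the set of errors is nonempty. *)
  exists (total_error e alpha L (ketbra psi0) phi (fun x : K => x, fun=> 0)).
  exists (fun x : K => x, fun=> 0) => //; split=> [||x /=]; last by rewrite addr0.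
    split=> [|x]; last exact: innerp_ge0.
    by split=> // x; exact: cvg_id.
  split=> [|x]; last by rewrite innerp0r.
  by split=> [a x y|x]; [rewrite scaler0 addr0|exact: cvg_cst].
move=> _ [M Mp <-]; have [p1 p2 M12] := Mp.
rewrite /total_error trace_op_power_comp // -/Psi0.
set S := [set _ | _ in _].
have supS j : complex.Re <(Psi j | M.1 (Psi j))> <= sup S.
  apply: ub_le_sup; first by exists 1; exact: alternative_errors_ub.
  exists (ketbra (psi j)); first exact: alt.
  by rewrite trace_op_power_comp.
(* The supremum dominates the mean over the n+1 states, which convexity bounds below by the form at
   D = r^n Psi0. *)
have HD : r ^+ 2 ^+ n * complex.Re <(Psi0 | M.1 Psi0)> <= sup S.
  rewrite -(ler_pM2l (ltr0Sn R n)).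
  apply: (@le_trans _ _ (\sum_j complex.Re <(Psi j | M.1 (Psi j))>)); last first.
    apply: le_trans (ler_sum _ (fun j _ => supS j)) _.
    by rewrite sumr_const card_ord mulr_natl.
  rewrite -lecR rmorph_sum /=.
  have RReq x : ((complex.Re <(x | M.1 x)>)%:C)%C = <(x | M.1 x)>.
    by rewrite RRe_real // ger0_real // p1.2.
  under [leRHS]eq_bigr do rewrite RReq.
  rewrite !rmorphM /= RReq rmorph_nat.
  apply: le_trans (positive_op_jensen p1 sumPsi).
  rewrite ler_pM2l ?ltr0Sn // /D tensZ prodr_const card_ord -/Psi0.
  have [[lM _] pM] := p1.
  set a := (r%:C)%C ^+ n; rewrite -(selfadjoint_of_ge0 lM pM (a *: Psi0)) innerpZr.
  rewrite (selfadjoint_of_ge0 lM pM) innerpZl mulrA -normCK.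
  by rewrite /a normrX exprAC ger0_norm ?ler0c // rmorphXn /= rmorphXn.
have E : complex.Re <(Psi0 | M.1 Psi0)> + complex.Re <(Psi0 | M.2 Psi0)> = 1.
  have : <(Psi0 | M.1 Psi0)> + <(Psi0 | M.2 Psi0)> = 1.
    by rewrite -innerpDr M12 -innerp_norm P1 expr1n.
  by case: <(_ | _)> => a b; case: <(_ | _)> => a' b' [].
have q2 : 0 <= complex.Re <(Psi0 | M.2 Psi0)> by apply: Re_ge0; exact: p2.2.
have rn1 : r ^+ 2 ^+ n <= 1 by rewrite -exprM exprn_ile1.
have rn0 : 0 <= r ^+ 2 ^+ n by rewrite -exprM exprn_ge0.
(* With p the probability of accepting under the null, the error is at least (1 - p) + r^(2n) p, and
   r^(2n) <= 1. *)
nra.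
Qed.

End error.

(** * Sobolev sums and perturbations of low index *)

Section sobolev.
Context {R : realType} {V : hilbertType R} (e : nat -> V) (alpha : R).
Hypothesis e_basis : orthonormal_basis e.

Lemma norm_basis j : `|e j| = 1.
Proof.
apply/eqP; rewrite -(@eqrXn2 _ 2) // expr1n innerp_norm; have [oe _] := e_basis.
by rewrite oe eqxx.
Qed.

Definition sobolev_term (x : V) (j : nat) : R :=
  complex.Re (`|<(e j | x)>| ^+ 2) * j%:R `^ (2 * alpha).

Lemma sobolev_term_ge0 x j : 0 <= sobolev_term x j.
Proof. by rewrite mulr_ge0 ?powR_ge0 // Re_ge0 ?exprn_ge0. Qed.

Lemma sobolev_sum_le (x y : V) (B d : R) : 0 <= d ->
  (forall j, sobolev_term y j <= sobolev_term x j + (j == 1)%:R * d) ->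
  (\sum_(0 <= j <oo) (sobolev_term x j)%:E <= B%:E)%E ->
  (\sum_(0 <= j <oo) (sobolev_term y j)%:E <= (B + d)%:E)%E.
Proof.
move=> d0 yx xB; apply: lime_le.
  by apply: is_cvg_nneseries => j _ _; rewrite lee_fin sobolev_term_ge0.
apply: nearW => N; rewrite sumEFin lee_fin.
apply: (le_trans (ler_sum _ (fun j _ => yx j))); rewrite big_split /= lerD //.
  rewrite -lee_fin -sumEFin; apply: le_trans xB.
  by apply: nneseries_lim_ge => j _ _; rewrite lee_fin sobolev_term_ge0.
rewrite -mulr_suml -[leRHS]mul1r ler_wpM2r //.
rewrite -natr_sum lern1 big_mkord.
case: (ltnP 1 N) => N1; last first.
  by rewrite big1 // => -[j jN] _ /=; case: j jN => [|[|j]]// /leq_trans/(_ N1).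
rewrite (bigD1 (Ordinal N1)) //= big1 // => i /negPf; rewrite -val_eqE /= => ->.
by [].
Qed.

(** With a_j = <psi0 | e_j>, take (a_1 e_0 - a_0 e_1) / sqrt (|a_0|^2 + |a_1|^2), or e_0 if a_0 =
    a_1 = 0. *)
Lemma exists_orthogonal_low (psi0 : V) : exists v : V,
  [/\ `|v| = 1, <(psi0 | v)> = 0 & forall j, (1 < j)%N -> <(e j | v)> = 0].
Proof.
have [oe _] := e_basis.
pose a j := <(psi0 | e j)>.
have vP (x y : R[i]) : `|x| ^+ 2 + `|y| ^+ 2 = 1 -> x * a 0 + y * a 1 = 0 ->
    exists v : V, [/\ `|v| = 1, <(psi0 | v)> = 0
                    & forall j, (1 < j)%N -> <(e j | v)> = 0].
  move=> xy1 xya; exists (x *: e 0 + y *: e 1); split.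
  - apply/eqP; rewrite -(@eqrXn2 _ 2) // expr1n innerp_norm.
    rewrite !(innerpDl, innerpDr, innerpZl, innerpZr) !oe /=.
    by rewrite !(mulr0, mulr1, addr0, add0r) -!normCKC xy1.
  - by rewrite innerpDr !innerpZr.
  - move=> j j1; rewrite innerpDr !innerpZr !oe.
    by case: j j1 => [|[|j]]// _; rewrite !mulr0 addr0.
have [a0|a0] := eqVneq (`|a 0| ^+ 2 + `|a 1| ^+ 2) 0.
  apply: (vP 1 0); first by rewrite normr1 normr0 expr1n expr0n addr0.
  move/eqP: a0; rewrite paddr_eq0 ?exprn_ge0 // !sqrf_eq0 !normr_eq0.
  by move=> /andP[/eqP -> /eqP ->]; rewrite !mulr0 addr0.
set q := _ + _ in a0; have q0 : 0 <= q by rewrite addr_ge0 ?exprn_ge0.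
have s0 : sqrtC q != 0 by rewrite sqrtC_eq0.
apply: (vP (a 1 / sqrtC q) (- a 0 / sqrtC q)).
  rewrite !normf_div normrN !expr_div_n -mulrDl addrC -/q.
  by rewrite (@ger0_norm _ (sqrtC q)) ?sqrtC_ge0 // sqrtCK divff.
by rewrite mulrAC [X in _ + X]mulrAC mulNr [a 0 * a 1]mulrC -mulrDl subrr mul0r.
Qed.

End sobolev.

(** * The exact minimax error for small radius *)

Section minimax.
Context {R : realType} {H : hilbertType R} (e : nat -> H).
Context {n : nat} (K : tensor_power H n) (alpha L L' : R) (psi0 : H).
Hypotheses (e_basis : orthonormal_basis e) (alpha_gt0 : 0 < alpha).
Hypothesis psi0_norm : `|psi0| = 1.
Hypothesis psi0_sobolev :
  (\sum_(0 <= j <oo) (sobolev_term e alpha psi0 j)%:E <= L'%:E)%E.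

Lemma minimax_errorE phi : 0 <= phi -> phi <= 2 -> L' + 3 * (phi / 2) <= L ->
  minimax_error K e alpha L (ketbra psi0) phi = (1 - phi ^+ 2 / 4) ^+ n.
Proof.
move=> phi0 phi2 L'L; apply/eqP; rewrite eq_le minimax_error_le //=.
have [v [v1 psi0v vj]] := exists_orthogonal_low e_basis psi0.
set r := Num.sqrt (1 - phi ^+ 2 / 4); set s := phi / 2.
have s0 : 0 <= s by rewrite divr_ge0.
have s1 : s <= 1 by rewrite ler_pdivrMr // mul1r.
have r2 : r ^+ 2 = 1 - s ^+ 2.
  by rewrite /r /s sqr_sqrtr; [field|nra].
have r0 : 0 <= r by rewrite sqrtr_ge0.
have r1 : r <= 1 by rewrite -(@ler_pXn2r _ 2) ?nnegrE // expr1n r2; nra.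
have -> : 1 - phi ^+ 2 / 4 = r ^+ 2 by rewrite r2 /s; field.
apply: (@minimax_error_ge _ _ _ _ _ _ _ e_basis _ _ psi0_norm phi0 ((s%:C)%C *: v)) => [|z z1].
  by rewrite r0 r1.
set psi := _ + _.
have rN : `|(r%:C)%C| = (r%:C)%C by rewrite ger0_norm ?ler0c.
have sN : `|(s%:C)%C| = (s%:C)%C by rewrite ger0_norm ?ler0c.
have psi0_ip : <(psi0 | psi0)> = 1 by exact: innerp_unit.
have psi1 : `|psi| = 1.
  apply/eqP; rewrite -(@eqrXn2 _ 2) // expr1n innerp_norm /psi.
  rewrite !(innerpDl, innerpDr, innerpZl, innerpZr) -(innerp_conj psi0 v) psi0v.
  rewrite psi0_ip (innerp_unit v1) !(rmorph0, mulr0, mulr1, addr0, add0r).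
  rewrite [_^* * (z * _)]mulrCA [z^* * _]mulrA -!normCKC z1 expr1n mul1r.
  rewrite rN sN -!rmorphXn -rmorphD /= r2 subrK.
  exact/eqP.
split.
  exists psi; split=> //.
  apply: (@le_trans _ _ (L' + 3 * s)%:E); last by rewrite lee_fin.
  apply: (@sobolev_sum_le _ _ _ _ psi0) psi0_sobolev; first by rewrite mulr_ge0.
  (* The weights of j = 0 and j = 1 are 0 and 1, and the coefficients with j > 1
     only shrink, so all the growth is in the term j = 1, where a modulus q <= 1
     becomes at most q + s and (q + s)^2 <= q^2 + 3 s. *)
  move=> j; have coefE : <(e j | psi)> = (r%:C)%C * <(e j | psi0)>
      + z * ((s%:C)%C * <(e j | v)>) by rewrite /psi innerpDr !innerpZr.
  case: j coefE => [|[|j]] coefE.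
  - have a0 : 2 * alpha != 0 by rewrite gt_eqF // mulr_gt0.
    by rewrite /sobolev_term powR0 // !mulr0 mul0r addr0.
  - rewrite /sobolev_term eqxx powR1 !mulr1 mul1r coefE.
    set a := <(_ | psi0)>; set b := <(_ | v)>.
    have RaE : ((complex.Re `|a|)%:C)%C = `|a| by rewrite RRe_real ?normr_real.
    have ra0 : 0 <= complex.Re `|a| by exact: Re_ge0.
    have ra1 : complex.Re `|a| <= 1.
      by apply: (@Re_le _ _ 1); apply: innerp_le1 => //; exact: (norm_basis e_basis).
    have b1 : `|b| <= 1 by apply: innerp_le1 => //; exact: (norm_basis e_basis).
    have le_ab : `|(r%:C)%C * a + z * ((s%:C)%C * b)| <= ((complex.Re `|a| + s)%:C)%C.
      rewrite rmorphD /= RaE (le_trans (ler_normD _ _)) // !normrM z1 mul1r.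
      rewrite rN sN lerD //.
        by rewrite -[leRHS]mul1r ler_wpM2r // lecR.
      by rewrite -[leRHS]mulr1 ler_wpM2l // ler0c.
    apply: (@le_trans _ _ ((complex.Re `|a| + s) ^+ 2)).
      apply: (@Re_le _ _ (((complex.Re `|a| + s) ^+ 2)%:C)%C); rewrite rmorphXn /=.
      by rewrite lerXn2r ?nnegrE // ler0c addr_ge0.
    have -> : complex.Re (`|a| ^+ 2) = complex.Re `|a| ^+ 2.
      by rewrite -{1}RaE -rmorphXn.
    by move: (complex.Re `|a|) ra0 ra1 => q q0 q1; nra.
  - rewrite mul0r addr0 /sobolev_term ler_wpM2r ?powR_ge0 //.
    apply: Re_le; rewrite coefE vj // !mulr0 addr0 normrM rN.
    rewrite lerXn2r ?nnegrE ?mulr_ge0 // ?ler0c //.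
    by rewrite -[leRHS]mul1r ler_wpM2r // lecR.
(* The overlap with [psi0] is exactly r^2 = 1 - phi^2 / 4, so these states lie on the boundary of
   the alternative. *)
apply/(separatedP e_basis) => //.
rewrite -lecR overlapE /psi innerpDr !innerpZr psi0v psi0_ip !(mulr0, mulr1, addr0).
rewrite rN -rmorphXn lecR /= r2 /s; nra.
Qed.

End minimax.

(** * Asymptotics of the exact error *)

Theorem theorem5p7 (R : realType) (H : hilbertType R) (e : nat -> H)
  (e_basis : orthonormal_basis e) (K : forall n, tensor_power H n)
  (alpha L L' : R) (alpha_gt0 : 0 < alpha) (L_gt0 : 0 < L) (L'_lt_L : L' < L)
  (psi0 : H) (psi0_HS : hermite_sobolev e alpha L' (ketbra psi0))
  (phi : nat -> R)
  (phi_gt0 : forall n, (0 < n)%N -> 0 < phi n)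
  (phi_decr : forall m n, (0 < m)%N -> (m <= n)%N -> phi n <= phi m)
  (phi_rate : separation_rate phi) :
  (n%:R^-1 * (phi n) ^- 2 *
     ln (minimax_error (K n) e alpha L (ketbra psi0) (phi n)))
    @[n --> \oo] --> - (1 / 4 : R).
Proof.
have [psi [psi1 psiL ->]] := psi0_HS.
have [c [C [_ phi_bound]]] := phi_rate.
(* The hypotheses on [phi] concern positive indices, hence the shift. *)
rewrite -cvg_shiftS /=.
have phi0 n : 0 < phi n.+1 by exact: phi_gt0.
have phi2 : phi n.+1 ^+ 2 @[n --> \oo] --> (0 : R).
  apply: (@squeeze_cvgr _ _ _ _ (fun=> 0) (fun n => C ^+ 2 * harmonic n)).
  - apply: nearW => n; rewrite exprn_ge0 ?(ltW (phi0 n)) //=.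
    rewrite ler_pdivlMr ?ltr0Sn //.
    have /andP[_ nC] := phi_bound n.+1 isT.
    have s0 : 0 <= Num.sqrt n.+1%:R * phi n.+1 by rewrite mulr_ge0 ?sqrtr_ge0 ?(ltW (phi0 n)).
    rewrite -[X in _ * X](@sqr_sqrtr R) // -exprMn mulrC.
    by rewrite lerXn2r // nnegrE // (le_trans s0).
  - exact: cvg_cst.
  - rewrite -[X in _ --> X](mulr0 (C ^+ 2)); apply: cvgM; first exact: cvg_cst.
    exact: cvg_harmonic.
have phi1 : phi n.+1 @[n --> \oo] --> (0 : R).
  rewrite (_ : (fun n => phi n.+1) = (fun n => Num.sqrt (phi n.+1 ^+ 2))).
    by rewrite -[X in _ --> X]sqrtr0; apply: continuous_cvg => //; exact: sqrt_continuous.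
  by apply/funext => n; rewrite sqrtr_sqr gtr0_norm.
have small d : 0 < d -> \forall n \near \oo, phi n.+1 < d.
  move=> d0; have /cvgrPdist_lt/(_ d d0) := phi1; apply: filterS => n.
  by rewrite sub0r normrN gtr0_norm.
(* For small phi the exact formula applies and the factor n from the logarithm cancels; phi < (L -
   L') / 3 makes 3 phi / 2 fit into the gap. *)
have E : \forall n \near \oo, n.+1%:R^-1 * phi n.+1 ^- 2 *
    ln (minimax_error (K n.+1) e alpha L (ketbra psi) (phi n.+1))
    = phi n.+1 ^- 2 * ln (1 - phi n.+1 ^+ 2 / 4).
  near=> n; rewrite (minimax_errorE _ e_basis alpha_gt0 psi1 psiL) ?(ltW (phi0 n)) //.
  - rewrite lnXn; last first.
      have : phi n.+1 < 1 by near: n; exact: small.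
      have := phi0 n; nra.
    by rewrite -[ln _ *+ _]mulr_natl mulrACA mulVf ?mul1r // pnatr_eq0.
  - by apply: ltW; near: n; exact: small.
  - have : phi n.+1 < (L - L') / 3.
      by near: n; apply: small; rewrite divr_gt0 // subr_gt0.
    have := phi0 n; lra.
apply: (cvg_trans (near_eq_cvg _)).
  by near=> n; symmetry; near: n; exact: E.
(* With t = phi^2 / 4, the squeeze is - t / (1 - t) <= ln (1 - t) <= - t divided by phi^2 = 4 t. *)
apply: (@squeeze_cvgr _ _ _ _ (fun n => - (1 / 4) / (1 - phi n.+1 ^+ 2 / 4))
                             (fun=> - (1 / 4))).
- near=> n.
  have t1 : phi n.+1 < 1 by near: n; exact: small.
  have p2 : 0 < phi n.+1 ^+ 2 by rewrite exprn_gt0.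
  have t0 : 0 < 1 - phi n.+1 ^+ 2 / 4 by have := phi0 n; nra.
  have t4 : phi n.+1 ^+ 2 / 4 < 1 by rewrite -subr_gt0.
  rewrite /= ler_pdivlMl // ler_pdivrMl //; apply/andP; split; last first.
    have -> : phi n.+1 ^+ 2 * - (1 / 4) = - (phi n.+1 ^+ 2 / 4) by field.
    by apply: le_ln1Dx; rewrite ltrN2.
  (* The lower bound is ln (1 + x) <= x applied to 1 / (1 - t) = 1 + t / (1 - t). *)
  rewrite -[leRHS]opprK -lnV ?posrE // lerNr.
  have -> : - (phi n.+1 ^+ 2 * (- (1 / 4) / (1 - phi n.+1 ^+ 2 / 4)))
      = (phi n.+1 ^+ 2 / 4) / (1 - phi n.+1 ^+ 2 / 4).
    by ring.
  have invE : (1 - phi n.+1 ^+ 2 / 4)^-1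
      = 1 + (phi n.+1 ^+ 2 / 4) / (1 - phi n.+1 ^+ 2 / 4).
    apply: (mulIf (lt0r_neq0 t0)).
    by rewrite mulVf ?lt0r_neq0 // mulrDl mul1r divfK ?lt0r_neq0 // subrK.
  rewrite [X in ln X]invE; apply: le_ln1Dx; apply: lt_le_trans (ltrN10 _) _.
  by rewrite !divr_ge0 ?ltW.
- rewrite -[X in _ --> X]divr1; apply: cvgM; first exact: cvg_cst.
  apply: cvgV; first exact: oner_neq0.
  rewrite -[X in _ --> X](subr0 1); apply: cvgB; first exact: cvg_cst.
  rewrite -[X in _ --> X](mul0r (4^-1)); apply: cvgM => //; exact: cvg_cst.
- exact: cvg_cst.
Unshelve. all: by end_near. Qed.
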